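(* Let $A\in\mathbb{R}^{m\times n}$, $y\in\mathbb{R}^m$, $\alpha,\beta>0$ and $0<q\le1$, and let $$\mathcal{T}_{\alpha,\beta}^q(u,v)=\frac12\|A(u+v)-y\|_2^2+\frac{\alpha}{q}\|u\|_q^q+\frac{\beta}{2}\|v\|_2^2,\qquad u,v\in\mathbb{R}^n .$$ A pair $(\hat u,\hat v)\in\mathbb{R}^n\times\mathbb{R}^n$ minimizes $\mathcal{T}_{\alpha,\beta}^q$ if and only if $$\hat v=v(\hat u):=\bigl(\beta\,\mathrm{Id}_n+A^\top A\bigr)^{-1}\bigl(A^\top y-A^\top A\hat u\bigr)$$ and $\hat u$ is a solution of the augmented problem $$\hat u\in\operatorname*{argmin}_{u\in\mathbb{R}^n}\mathcal{F}_\beta(u),\qquad \mathcal{F}_\beta(u):=\frac12\|B_\beta u-y_\beta\|_2^2+\frac{\alpha}{q}\|u\|_q^q,$$ where $$B_\beta=\Bigl(\mathrm{Id}_m+\frac{AA^\top}{\beta}\Bigr)^{-1/2}A,\qquad y_\beta=\Bigl(\mathrm{Id}_m+\frac{AA^\top}{\beta}\Bigr)^{-1/2}y .$$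
   Context: $\mathrm{Id}_n$ is the $n\times n$ identity matrix and $\|u\|_q^q=\sum_i|u_i|^q$. ''Minimizes'' means global minimizer. *)

(* Defs.v *)
From mathcomp Require Import all_boot all_order all_algebra.
From mathcomp Require Import all_classical all_reals all_analysis.

Set Implicit Arguments.
Unset Strict Implicit.
Unset Printing Implicit Defensive.

Import Order.TTheory GRing.Theory Num.Theory.

Local Open Scope ring_scope.

Definition is_global_minimizer (R : realType) (T : Type) (f : T -> R) (x : T) :
    Prop :=
  forall y : T, f x <= f y.

(* ||u||_q^q, used for q > 0 (also for q = 2, the squared Euclidean norm);
   note that powR 0 q = 0 for q != 0. *)
Definition normqq (R : realType) (n : nat) (q : R) (u : 'cV[R]_n) : R :=
  \sum_(i < n) `|u i 0| `^ q.

Definition sym_psd (R : realType) (n : nat) (S : 'M[R]_n) : Prop :=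
  S^T = S /\ forall x : 'cV[R]_n, 0 <= (x^T *m S *m x) 0 0.

(* The square root of a symmetric positive semidefinite M is its unique
   symmetric positive semidefinite square root; sqrtmx M is 0 by convention
   when M has no such root. *)
Definition sqrtmx (R : realType) (n : nat) (M : 'M[R]_n) : 'M[R]_n :=
  xget 0 [set S : 'M[R]_n | sym_psd S /\ S *m S = M]%classic.

Definition invsqrtmx (R : realType) (n : nat) (M : 'M[R]_n) : 'M[R]_n :=
  invmx (sqrtmx M).

Definition Tfun (R : realType) (m n : nat) (A : 'M[R]_(m, n)) (y : 'cV[R]_m)
    (alpha beta q : R) (u v : 'cV[R]_n) : R :=
  1 / 2 * normqq 2 (A *m (u + v) - y) + alpha / q * normqq q u
  + beta / 2 * normqq 2 v.

Definition vsol (R : realType) (m n : nat) (A : 'M[R]_(m, n)) (y : 'cV[R]_m)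
    (beta : R) (u : 'cV[R]_n) : 'cV[R]_n :=
  invmx (beta *: 1%:M + A^T *m A) *m (A^T *m y - A^T *m A *m u).

Definition precond (R : realType) (m n : nat) (A : 'M[R]_(m, n)) (beta : R) :
    'M[R]_m :=
  invsqrtmx (1%:M + beta^-1 *: (A *m A^T)).

Definition Bmx (R : realType) (m n : nat) (A : 'M[R]_(m, n)) (beta : R) :
    'M[R]_(m, n) :=
  precond A beta *m A.

Definition yvec (R : realType) (m n : nat) (A : 'M[R]_(m, n)) (y : 'cV[R]_m)
    (beta : R) : 'cV[R]_m :=
  precond A beta *m y.

Definition Ffun (R : realType) (m n : nat) (A : 'M[R]_(m, n)) (y : 'cV[R]_m)
    (alpha beta q : R) (u : 'cV[R]_n) : R :=
  1 / 2 * normqq 2 (Bmx A beta *m u - yvec A y beta) + alpha / q * normqq q u.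

(* Main.v *)
(** Put [r = A u - y], [N = beta Id + A^T A] and [M = Id + A A^T / beta], and
    let [v0 = - N^-1 A^T r] be the candidate for [v].  The residual
    [s = r + A v0] satisfies [A^T s = - beta v0], hence [M s = r], and
    completing the square in [v] gives
      [T(u, v) = F(u) + 1/2 |A (v - v0)|^2 + beta/2 |v - v0|^2],
    the first term of [F] being [1/2 |M^(-1/2) r|^2 = 1/2 <s, r>].  The
    equivalence follows.  The square root of a positive semidefinite [M] is
    [p(M)^2], where [p] interpolates the fourth root on the spectrum of [M]. *)
Require Import Defs.
From mathcomp Require Import all_boot all_order all_algebra.
From mathcomp Require Import all_classical all_reals all_analysis.
From mathcomp Require Import complex ring.

Set Implicit Arguments.
Unset Strict Implicit.
Unset Printing Implicit Defensive.

Import Order.TTheory GRing.Theory Num.Theory.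

Local Open Scope ring_scope.

Lemma poly_interpolation (F : fieldType) (f : F -> F) (s : seq F) :
  exists p : {poly F}, forall x, x \in s -> p.[x] = f x.
Proof.
elim: s => [|a s [p hp]]; first by exists 0.
have [as_|nas] := boolP (a \in s).
  by exists p => x; rewrite inE => /predU1P[->|]; apply: hp.
(* The polynomial [w] vanishes on [s] but not at [a], so adding a multiple of it to [p] corrects the
   value at [a] alone. *)
set w := \prod_(b <- s) ('X - b%:P).
have wa : w.[a] != 0 by move: nas; rewrite -root_prod_XsubC.
exists (p + ((f a - p.[a]) / w.[a]) *: w) => x.
rewrite inE !hornerE => /predU1P[->|xs]; first by rewrite divfK // addrC subrK.
have /eqP -> : w.[x] == 0 by move: xs; rewrite -root_prod_XsubC.
by rewrite mulr0 addr0 hp.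
Qed.

Lemma trmx_horner_mx (R : comNzRingType) (n : nat) (M : 'M[R]_n.+1)
    (p : {poly R}) : (horner_mx M p)^T = horner_mx M^T p.
Proof.
elim/poly_ind: p => [|p c IH]; first by rewrite !rmorph0 trmx0.
rewrite !rmorphD !rmorphM /= !horner_mx_X !horner_mx_C linearD /= tr_scalar_mx.
rewrite [X in X^T + _]/GRing.mul /= trmx_mul IH.
by rewrite (comm_mx_horner p (comm_mx_refl _)).
Qed.

(** The diagonalizing [P] may exist only over the extension [L]; the identity is checked there on
    the diagonal and descends to [F] because [map_mx f] is injective. *)
Lemma eq_horner_mx_diag (F L : fieldType) (f : {rmorphism F -> L}) (n : nat)
    (M : 'M[F]_n.+1) (P : 'M[L]_n.+1) (d : 'rV[F]_n.+1) (p r : {poly F}) :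
    P \in unitmx -> map_mx f M = invmx P *m diag_mx (map_mx f d) *m P ->
  (forall i, p.[d 0 i] = r.[d 0 i]) -> horner_mx M p = horner_mx M r.
Proof.
move=> uP ME pr; apply: (@map_mx_inj _ _ f).
rewrite !map_horner_mx ME !horner_mx_uconjC // !horner_mx_diag.
congr (_ *m diag_mx _ *m _); apply/rowP => i.
by rewrite !mxE !horner_map /= pr.
Qed.

Section Dot.
Context {R : realType}.

Definition dotv {n : nat} (x y : 'cV[R]_n) : R := (x^T *m y) 0 0.

Lemma normqq2 n (x : 'cV[R]_n) : normqq 2 x = dotv x x.
Proof.
rewrite /normqq /dotv mxE; apply: eq_bigr => i _.
by rewrite mxE -[2]/(2%:R) powR_mulrn // -normrX ger0_norm ?sqr_ge0 // expr2.
Qed.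

Lemma dotvC n (x y : 'cV[R]_n) : dotv x y = dotv y x.
Proof. by rewrite /dotv -[x^T *m y]trmxK trmx_mul trmxK mxE. Qed.

Lemma dotvDl n (x y z : 'cV[R]_n) : dotv (x + y) z = dotv x z + dotv y z.
Proof. by rewrite /dotv linearD mulmxDl mxE. Qed.

Lemma dotvDr n (x y z : 'cV[R]_n) : dotv x (y + z) = dotv x y + dotv x z.
Proof. by rewrite /dotv mulmxDr mxE. Qed.

Lemma dotvZr n (a : R) (x y : 'cV[R]_n) : dotv x (a *: y) = a * dotv x y.
Proof. by rewrite /dotv -scalemxAr mxE. Qed.

Lemma dotvNr n (x y : 'cV[R]_n) : dotv x (- y) = - dotv x y.
Proof. by rewrite /dotv mulmxN mxE. Qed.

Lemma dotv_mull m n (A : 'M[R]_(m, n)) x y : dotv (A *m x) y = dotv x (A^T *m y).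
Proof. by rewrite /dotv trmx_mul mulmxA. Qed.

Lemma dotv_ge0 n (x : 'cV[R]_n) : 0 <= dotv x x.
Proof. by rewrite /dotv mxE sumr_ge0 // => i _; rewrite mxE -expr2 sqr_ge0. Qed.

Lemma dotv_eq0 n (x : 'cV[R]_n) : (dotv x x == 0) = (x == 0).
Proof.
apply/eqP/eqP => [|->]; last by rewrite /dotv mulmx0 mxE.
rewrite /dotv mxE => /eqP; rewrite psumr_eq0 => [/allP h|i _]; last first.
  by rewrite mxE -expr2 sqr_ge0.
apply/colP => i; have /implyP := h i (mem_index_enum i).
by rewrite !mxE mulf_eq0 orbb => /(_ isT)/eqP.
Qed.

(** The spectral theorem is applied over the complex numbers. Taking the root as a real polynomial
    in [M] keeps it real and symmetric, and writing it as the square of a symmetric [T] makes it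
    positive semidefinite, since [x^T T T x = |T x|^2]. *)
Lemma sym_psd_sqrt_exists n (M : 'M[R]_n) :
  sym_psd M -> exists S : 'M[R]_n, sym_psd S /\ S *m S = M.
Proof.
case: n M => [|n] M [symM psdM].
  by exists M; split; [split | rewrite [LHS]flatmx0 flatmx0].
pose toC := real_complex R; pose A := map_mx toC M.
have hermA : A \is hermsymmx.
  apply: realsym_hermsym.
    by apply/is_hermitianmxP; rewrite expr0 scale1r map_mx_id // map_trmx symM.
  apply/mxOverP => i j; rewrite mxE; apply/complex_realP; by exists (M i j).
pose P := spectralmx A; pose D := spectral_diag A.
have uP : P \in unitmx := spectral_unit A.
have AE : A = invmx P *m diag_mx D *m P.
  exact/orthomx_spectralP/hermitian_normalmx.
have /mxOverP realD := hermitian_spectral_diag_real hermA.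
pose d i := complex.Re (D 0 i).
have dE i : D 0 i = toC (d i).
  by have /complex_realP[x hx] := realD 0 i; rewrite /d hx.
have DE : D = map_mx toC (\row_i d i) by apply/rowP => i; rewrite 2!mxE dE.
(* The row [i] of [P] is a complex eigenvector for [d i]. Being an eigenvalue descends to the real
   field, which gives a real eigenvector [x] to test positivity on: [d i * |x|^2 >= 0]. *)
have d_ge0 i : 0 <= d i.
  have : eigenvalue A (toC (d i)).
    apply/eigenvalueP; exists (row i P).
      rewrite -row_mul AE !mulmxA mulmxV // mul1mx -dE.
      by apply/rowP => j; rewrite mul_diag_mx !mxE.
    apply: contraTneq isT => /(congr1 (mulmx^~ (invmx P))).
    rewrite -row_mul mulmxV // mul0mx => /rowP/(_ i)/eqP.
    by rewrite !mxE eqxx oner_eq0.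
  rewrite eigenvalue_map => /eigenvalueP[x xM x0].
  have := psdM x^T; rewrite trmxK xM -scalemxAl mxE -{1}(trmxK x) -/(dotv x^T x^T).
  rewrite pmulr_lge0 // lt_neqAle dotv_ge0 andbT eq_sym dotv_eq0.
  by rewrite -(inj_eq (@trmx_inj _ _ _)) trmxK trmx0.
have [p hp] := poly_interpolation (fun x => Num.sqrt (Num.sqrt x)) (codom d).
pose T := horner_mx M p.
have symT : T^T = T by rewrite trmx_horner_mx symM.
exists (T *m T); split; first split.
- by rewrite trmx_mul symT.
- by move=> x; rewrite mulmxA -{1}symT -trmx_mul -mulmxA dotv_ge0.
have -> : T *m T *m (T *m T) = horner_mx M (p * p * (p * p)) by rewrite !rmorphM.
rewrite -[RHS]horner_mx_X; rewrite DE in AE; apply: (eq_horner_mx_diag uP AE).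
(* On the spectrum the fourth power of [p] agrees with ['X]; nonnegativity of [d i] is what makes
   squaring undo the roots. *)
move=> i; rewrite mxE hornerX !hornerM hp ?codom_f // -!expr2.
by rewrite !sqr_sqrtr ?sqrtr_ge0.
Qed.

Lemma sqrtmxP n (M : 'M[R]_n) :
  sym_psd M -> sym_psd (sqrtmx M) /\ sqrtmx M *m sqrtmx M = M.
Proof.
move=> /sym_psd_sqrt_exists[S hS]; rewrite /sqrtmx.
by case: xgetP => [? _ //|/(_ S)/(_ hS)].
Qed.

Lemma unitmx_ker0 n (M : 'M[R]_n) :
  (forall x : 'cV_n, M *m x = 0 -> x = 0) -> M \in unitmx.
Proof.
move=> inj; rewrite -unitmx_tr -row_free_unit -kermx_eq0.
apply/eqP/row_matrixP => i; rewrite row0; apply: trmx_inj; rewrite trmx0.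
by apply/inj/trmx_inj; rewrite trmx_mul trmxK -row_mul mulmx_ker row0 trmx0.
Qed.

End Dot.

Section Splitting.
Context {R : realType} {m n : nat} (A : 'M[R]_(m, n)) (y : 'cV[R]_m).
Context (alpha beta q : R) (beta_gt0 : 0 < beta).

Let M : 'M[R]_m := 1%:M + beta^-1 *: (A *m A^T).
Let N : 'M[R]_n := beta *: 1%:M + A^T *m A.

Let mulN (x : 'cV_n) : N *m x = beta *: x + A^T *m (A *m x).
Proof. by rewrite mulmxDl -scalemxAl mul1mx mulmxA. Qed.

Let mulM (x : 'cV_m) : M *m x = x + beta^-1 *: (A *m (A^T *m x)).
Proof. by rewrite mulmxDl mul1mx -scalemxAl mulmxA. Qed.

Let N_unit : N \in unitmx.
Proof.
(* Pairing [N x = 0] with [x] gives [beta |x|^2 + |A x|^2 = 0], which forces [x = 0]. *)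
apply: unitmx_ker0 => x /(congr1 (dotv x)).
rewrite mulN dotvDr dotvZr -dotv_mull {3}/dotv mulmx0 mxE => h.
apply/eqP; rewrite -dotv_eq0 eq_le dotv_ge0 andbT.
by rewrite -(pmulr_rle0 _ beta_gt0) -h lerDl dotv_ge0.
Qed.

Let dotvM x : dotv x (M *m x) = dotv x x + beta^-1 * dotv (A^T *m x) (A^T *m x).
Proof. by rewrite mulM dotvDr dotvZr [dotv (A^T *m x) _]dotv_mull trmxK. Qed.

Let M_psd : sym_psd M.
Proof.
split; first by rewrite /M linearD /= trmx1 linearZ /= trmx_mul trmxK.
move=> x; rewrite -mulmxA -/(dotv x (M *m x)) dotvM.
by rewrite addr_ge0 ?mulr_ge0 ?dotv_ge0 // invr_ge0 ltW.
Qed.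

Let M_unit : M \in unitmx.
Proof.
apply: unitmx_ker0 => x /(congr1 (dotv x)).
rewrite dotvM {3}/dotv mulmx0 mxE => h.
apply/eqP; rewrite -dotv_eq0 eq_le dotv_ge0 andbT -h lerDl.
by rewrite mulr_ge0 ?dotv_ge0 // invr_ge0 ltW.
Qed.

(** With [S = sqrtmx M], one has [S^-1 M s = S^-1 S S s = S s], and [|S s|^2] becomes the right-hand
    side by symmetry of [S]. *)
Lemma normqq_precond (s : 'cV[R]_m) :
  normqq 2 (precond A beta *m (M *m s)) = dotv s (M *m s).
Proof.
have [[symS _] SS] := sqrtmxP M_psd.
have S_unit : sqrtmx M \in unitmx.
  by move: M_unit; rewrite -{1}SS unitmx_mul andbb.
rewrite normqq2 /precond /invsqrtmx -/M -{2 4}SS -!mulmxA mulKmx //.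
by rewrite dotv_mull symS mulmxA SS.
Qed.

Lemma Tfun_split u v : let w := v - vsol A y beta u in
  Tfun A y alpha beta q u v =
  Ffun A y alpha beta q u
  + (1 / 2 * dotv (A *m w) (A *m w) + beta / 2 * dotv w w).
Proof.
move=> w; set v0 := vsol A y beta u in w *; pose r := A *m u - y.
pose s := r + A *m v0.
(* Here [A^T s + beta v0 = N v0 + A^T r], which is zero by the choice of [v0]. *)
have Ns : A^T *m s = - (beta *: v0).
  apply/eqP; rewrite -addr_eq0 /s mulmxDr -addrA [X in _ + X]addrC -mulN.
  by rewrite /v0 /vsol mulKVmx // /r mulmxBr !mulmxA addrA subrK subrr.
have Ms : M *m s = r.
  rewrite mulM Ns mulmxN -scalemxAr scalerN scalerA mulVf ?gt_eqF //.
  by rewrite scale1r addrK.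
have vE : v = v0 + w by rewrite addrC subrK.
have rE : A *m (u + v) - y = s + A *m w.
  by rewrite /s /r vE !mulmxDr addrA [_ - y]addrAC [_ + _ - y]addrAC.
have fE : Bmx A beta *m u - yvec A y beta = precond A beta *m (M *m s).
  by rewrite Ms /r mulmxBr mulmxA.
(* At [x = w] this cancels the cross terms of the two squares; at [x = v0] it evaluates
   [dotv s r]. *)
have sA x : dotv s (A *m x) = - (beta * dotv v0 x).
  by rewrite dotvC dotv_mull Ns dotvNr dotvZr dotvC.
have sr : dotv s r = dotv s s + beta * dotv v0 v0.
  by rewrite -[r](addrK (A *m v0)) -/s dotvDr dotvNr sA opprK.
clearbody s r w v0.
rewrite /Tfun /Ffun rE fE normqq_precond Ms sr !normqq2 vE.
rewrite !dotvDl !dotvDr [dotv (A *m w) s]dotvC [dotv w v0]dotvC sA.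
by move: (alpha / q * _) => c; field.
Qed.

End Splitting.

Theorem lemma2p4 (R : realType) (m n : nat) (A : 'M[R]_(m, n)) (y : 'cV[R]_m)
    (alpha beta q : R) (halpha : 0 < alpha) (hbeta : 0 < beta)
    (hq0 : 0 < q) (hq1 : q <= 1) (uhat vhat : 'cV[R]_n) :
  is_global_minimizer
    (fun w : 'cV[R]_n * 'cV[R]_n => Tfun A y alpha beta q w.1 w.2)
    (uhat, vhat)
  <->
  vhat = vsol A y beta uhat /\
  is_global_minimizer (Ffun A y alpha beta q) uhat.
Proof.
(* [TF] and [FT] together say that [F(u)] is the minimum of [T(u, v)] over [v], attained at
   [vsol]. *)
have TF u : Tfun A y alpha beta q u (vsol A y beta u) = Ffun A y alpha beta q u.
  by rewrite Tfun_split //= subrr mulmx0 /dotv !mulmx0 !mxE !mulr0 !addr0.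
have FT u v : Ffun A y alpha beta q u <= Tfun A y alpha beta q u v.
  rewrite Tfun_split //= lerDl.
  by rewrite addr_ge0 // mulr_ge0 ?dotv_ge0 // divr_ge0 // ltW.
rewrite /is_global_minimizer; split=> [minT|[-> minF] [u v]] /=; last first.
  by rewrite TF (le_trans (minF u)).
split=> [|u]; last first.
  by rewrite -[leRHS]TF; apply: le_trans (FT _ _) (minT (u, _)).
(* Comparing [vhat] with [vsol] at the same [uhat] makes the quadratic remainder nonpositive, so its
   [beta/2 |w|^2] part vanishes. *)
have := minT (uhat, vsol A y beta uhat); rewrite /= TF Tfun_split //=.
set w := vhat - _; rewrite gerDl => w_le0.
apply/eqP; rewrite -subr_eq0 -/w -dotv_eq0 eq_le dotv_ge0 andbT.
rewrite -(pmulr_rle0 _ (divr_gt0 hbeta (ltr0Sn _ 1))).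
by apply: le_trans w_le0; rewrite lerDr mulr_ge0 ?dotv_ge0 ?divr_ge0.
Qed.
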